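(* For every $t\in\mathbb Z^+\cup\{\infty\}$ and every pair of error measures $(\eta_0,\eta_1)$, $\mathrm{BDIS}_t$ is as hard as $\mathrm{MAT}_{\lfloor t/2\rfloor+1}$ with respect to $(\eta_0,\eta_1)$ (with $\lfloor \infty/2\rfloor+1=\infty$).
   Context: Online problems with binary predictions: an instance is $I=(x,\hat x,r)$, $r=(r_1,\dots,r_n)$ requests, $x,\hat x\in\{0,1\}^n$; requests are revealed one at a time, with $r_i$ the deterministic online algorithm receives prediction $\hat x_i$ and must irrevocably output $y_i\in\{0,1\}$ before the next request; the unrevealed $x$ encodes an optimal solution. $\mathrm{Alg}(I),\mathrm{Opt}(I)$ denote profits. An error-measure pair $(\eta_0,\eta_1)$ assigns to each instance values $0\le\eta_b(I)<\infty$, $\eta_b$ being a function of the incorrectly predicted requests with prediction $b$. For $\alpha,\beta,\gamma\ge0$, an algorithm for a maximization problem is $(\alpha,\beta,\gamma)$-competitive w.r.t. $(\eta_0,\eta_1)$ if there is a constant $b$ with $\mathrm{Opt}(I)\le\alpha\mathrm{Alg}(I)+\beta\eta_0(I)+\gamma\eta_1(I)+b$ for all instances $I$. It is Pareto-optimal if for no $\varepsilon>0$ is there an $(\alpha-\varepsilon,\beta,\gamma)$-, $(\alpha,\beta-\varepsilon,\gamma)$- or $(\alpha,\beta,\gamma-\varepsilon)$-competitive algorithm. $Q$ is as hard as $P$ w.r.t. $(\eta_0,\eta_1)$ if for all $\alpha,\beta,\gamma$, an $(\alpha,\beta,\gamma)$-competitive Pareto-optimal algorithm for $Q$ implies an $(\alpha,\beta,\gamma)$-competitive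 algorithm for $P$. $\mathrm{BDIS}_t$: vertex-arrival (request $r_i$ is a new vertex $v_i$ with all edges of the input graph $G$ to $v_1,\dots,v_{i-1}$), $G$ has maximum degree at most $t$ (no bound if $t=\infty$); $y_i=0$ accepts $v_i$; $\{v_i:x_i=0\}$ is a maximum independent set; profit $\sum_i(1-y_i)$ if accepted vertices are independent, else $-\infty$. $\mathrm{MAT}_s$: each request is an edge $e_i$ of the input graph $G$ together with its endpoints; $G$ has maximum degree at most $s$; $y_i=0$ accepts $e_i$; $\{e_i:x_i=0\}$ is a maximum matching of $G$; profit $\sum_i(1-y_i)$ if the accepted edges form a matching, else $-\infty$. *)

(* Defs.v *)
From HB Require Import structures.
From mathcomp Require Import all_boot all_order all_algebra.
From mathcomp Require Import finmap.
From mathcomp Require Import constructive_ereal reals.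

Set Implicit Arguments.
Unset Strict Implicit.
Unset Printing Implicit Defensive.

Import Order.TTheory GRing.Theory Num.Theory.
Local Open Scope ring_scope.

Record problem (R : realType) := Problem {
  request : Type;
  legal : seq request -> Prop;
  (* [encodes_opt r x]: the bits [x] encode an optimal solution for [r] *)
  encodes_opt : seq request -> bitseq -> Prop;
  profit : seq request -> bitseq -> \bar R }.

Record instance (R : realType) (P : problem R) := Instance {
  opt_bits : bitseq;
  pred_bits : bitseq;
  requests : seq (request P);
  size_opt_bits : size opt_bits = size requests;
  size_pred_bits : size pred_bits = size requests;
  legal_requests : legal requests;
  opt_bitsP : encodes_opt requests opt_bits }.

(* The i-th output depends exactly on the first i requests and predictions;
   earlier outputs need not be passed, as they are determined by these. *)
Definition algorithm (R : realType) (P : problem R) :=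
  seq (request P * bool) -> bool.

Definition run (R : realType) (P : problem R) (A : algorithm P)
    (r : seq (request P)) (xhat : bitseq) : bitseq :=
  mkseq (fun i => A (take i.+1 (zip r xhat))) (size r).

Definition Alg (R : realType) (P : problem R) (A : algorithm P)
    (I : instance P) : \bar R :=
  profit (requests I) (run A (requests I) (pred_bits I)).

Definition Opt (R : realType) (P : problem R) (I : instance P) : \bar R :=
  profit (requests I) (opt_bits I).

(* The set of requests wrongly predicted with prediction [b], as its
   characteristic vector over the positions of the request sequence. *)
Definition mispredicted (R : realType) (P : problem R) (b : bool)
    (I : instance P) : bitseq :=
  [seq (p.2 == b) && (p.1 != p.2) | p <- zip (opt_bits I) (pred_bits I)].

(* One pair is used for problems with different request types, so requests are
   identified by their position. [error false] is eta_0, [error true] eta_1. *)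
Record error_measures (R : realType) := ErrorMeasures {
  error : bool -> bitseq -> R;
  error_ge0 : forall b m, 0 <= error b m }.

Definition eta (R : realType) (E : error_measures R) (b : bool)
    (P : problem R) (I : instance P) : R :=
  error E b (mispredicted b I).

(* In [\bar R], [0 * -oo = 0]. For [alpha = 0] this does not affect which
   triples are attained: rejecting everything has profit 0 in the problems
   below, so it satisfies the same inequality. *)
Definition competitive (R : realType) (E : error_measures R) (P : problem R)
    (A : algorithm P) (alpha beta gamma : R) : Prop :=
  [/\ 0 <= alpha, 0 <= beta, 0 <= gamma &
    exists b : R, forall I : instance P,
      (Opt I <= alpha%:E * Alg A I + beta%:E * (eta E false I)%:E
                + gamma%:E * (eta E true I)%:E + b%:E)%E].

Definition pareto_optimal (R : realType) (E : error_measures R) (P : problem R)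
    (A : algorithm P) (alpha beta gamma : R) : Prop :=
  competitive E A alpha beta gamma /\
  forall eps : R, 0 < eps ->
    [/\ ~ (exists A' : algorithm P, competitive E A' (alpha - eps) beta gamma),
        ~ (exists A' : algorithm P, competitive E A' alpha (beta - eps) gamma) &
        ~ (exists A' : algorithm P, competitive E A' alpha beta (gamma - eps))].

Definition as_hard_as (R : realType) (E : error_measures R)
    (Q P : problem R) : Prop :=
  forall alpha beta gamma : R,
    (exists A : algorithm Q, pareto_optimal E A alpha beta gamma) ->
    exists B : algorithm P, competitive E B alpha beta gamma.

Definition accepted (n : nat) (y : bitseq) : {set 'I_n} :=
  [set i : 'I_n | nth true y i == false].

Definition maximum (n : nat) (feasible : pred {set 'I_n}) (S : {set 'I_n}) :=
  feasible S /\ forall S' : {set 'I_n}, feasible S' -> (#|S'| <= #|S|)%N.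

Definition selection_problem (R : realType) (T : Type)
    (legal : seq T -> Prop)
    (feasible : forall r : seq T, pred {set 'I_(size r)}) : problem R :=
  {| request := T;
     legal := legal;
     encodes_opt := fun r x => maximum (feasible r) (accepted (size r) x);
     profit := fun r y =>
       if feasible r (accepted (size r) y)
       then (\sum_(b <- y) (1 - b%:R))%:E else -oo%E |}.

(* Degree bounds lie in N + {oo}, with [None] for oo. *)
Definition degree_le (d : nat) (t : option nat) : bool :=
  if t is Some k then (d <= k)%N else true.

(* Vertices are named by their arrival position (from 0); the request at
   position [i] is the set of earlier neighbours of vertex [i]. *)
Definition adjacent (r : seq {fset nat}) (i j : nat) : bool :=
  (j \in nth fset0 r i) || (i \in nth fset0 r j).

Definition BDIS_legal (t : option nat) (r : seq {fset nat}) : Prop :=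
  (forall i j : nat, j \in nth fset0 r i -> (j < i)%N) /\
  (forall i : 'I_(size r),
     degree_le #|[set j : 'I_(size r) | adjacent r i j]| t).

Definition independent (r : seq {fset nat}) : pred {set 'I_(size r)} :=
  fun S => [forall i in S, forall j in S, ~~ adjacent r i j].

Definition BDIS (R : realType) (t : option nat) : problem R :=
  selection_problem R (BDIS_legal t) independent.

(* A request is an edge, as the set of its two endpoints; vertices are labelled
   by natural numbers. *)
Definition MAT_legal (s : option nat) (r : seq {fset nat}) : Prop :=
  [/\ forall e : {fset nat}, e \in r -> #|` e| = 2%N,
      uniq r &
      forall v : nat,
        degree_le #|[set i : 'I_(size r) | v \in nth fset0 r i]| s].

Definition matching (r : seq {fset nat}) : pred {set 'I_(size r)} :=
  fun M => [forall i in M, forall j in M,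
    (i != j) ==> [disjoint nth fset0 r i & nth fset0 r j]%fset].

Definition MAT (R : realType) (s : option nat) : problem R :=
  selection_problem R (MAT_legal s) matching.

(* Main.v *)
(** A matching is an independent set of the line graph, and the line graph can
    be built online, since the edges meeting a new edge among those already
    revealed are known on its arrival. An edge meets at most [s - 1] others at
    each of its two ends, so the line graph of a graph of maximum degree
    [s = t %/ 2 + 1] has maximum degree at most [2 * (s - 1) <= t]. Passing to
    the line graph preserves bits, profits and errors, hence an algorithm for
    BDIS with its guarantee is pulled back to one for MAT. *)

Require Import Defs.
From mathcomp Require Import all_boot all_order all_algebra.
From mathcomp Require Import finmap.
From mathcomp Require Import reals.
From mathcomp Require Import zify.

Set Implicit Arguments.
Unset Strict Implicit.
Unset Printing Implicit Defensive.

Lemma take_zip (S T : Type) k (r : seq S) (x : seq T) :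
  take k (zip r x) = zip (take k r) (take k x).
Proof.
by elim: k r x => [|k IH] [|a r] [|b x] //=; rewrite IH.
Qed.

Section LineGraph.

Implicit Types (r : seq {fset nat}) (x : bitseq) (t : option nat).

Definition edges_meet r (i j : nat) : bool :=
  ~~ [disjoint nth fset0 r i & nth fset0 r j]%fset.

Lemma edges_meetC r i j : edges_meet r i j = edges_meet r j i.
Proof. by rewrite /edges_meet fdisjoint_sym. Qed.

(** Searching [iota 0 i] only makes entry [i] depend on the first [i.+1] edges, and keeps an edge
    from being its own neighbour. *)
Definition line_graph r : seq {fset nat} :=
  mkseq (fun i => [fset j in iota 0 i | edges_meet r i j]%fset) (size r).

Lemma size_line_graph r : size (line_graph r) = size r.
Proof. exact: size_mkseq. Qed.

Lemma in_nth_line_graph r i j :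
  (j \in nth fset0 (line_graph r) i) = [&& i < size r, j < i & edges_meet r i j].
Proof.
have [ltir | leri] := ltnP i (size r); last first.
  by rewrite nth_default ?size_line_graph // in_fset0.
by rewrite nth_mkseq // !inE /= mem_iota.
Qed.

(** This is what makes the reduction online: entry [i < k] only looks up positions up to [i], all
    inside the prefix. *)
Lemma take_line_graph k r : line_graph (take k r) = take k (line_graph r).
Proof.
apply: (@eq_from_nth _ fset0) => [|i].
  by rewrite !(size_take, size_line_graph).
rewrite size_line_graph => ltik.
have /andP[ltk ltr] : (i < k) && (i < size r) by rewrite -ltn_min -size_take_min.
rewrite nth_take //; apply/fsetP => j; rewrite !in_nth_line_graph ltik ltr /=.
have [ltji | //] := ltnP j i.
by rewrite /edges_meet !nth_take //; apply: ltn_trans ltk.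
Qed.

(** Only the later of two edges lists the other, so one disjunct of [adjacent] survives. On the
    diagonal both fail although a nonempty edge meets itself, hence [i != j]. *)
Lemma adjacent_line_graph r i j : i < size r -> j < size r ->
  adjacent (line_graph r) i j = (i != j) && edges_meet r i j.
Proof.
move=> ltir ltjr; rewrite /adjacent !in_nth_line_graph ltir ltjr /=.
by rewrite (edges_meetC r j); case: ltngtP; rewrite ?orbF.
Qed.

(** The two index types differ by a merely propositional equality of sizes, so vertex sets are
    transported along [cast_ord]. *)
Lemma independent_line_graph r (S : {set 'I_(size r)}) :
  independent (cast_ord (size_line_graph r) @^-1: S) = matching S.
Proof.
apply/forall_inP/forall_inP => H i iS; apply/forall_inP => j jS.
  have castK := cast_ordKV (size_line_graph r).
  have := H (cast_ord (esym (size_line_graph r)) i).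
  rewrite inE castK => /(_ iS)/forall_inP.
  move=> /(_ (cast_ord (esym (size_line_graph r)) j)).
  rewrite inE castK => /(_ jS).
  by rewrite adjacent_line_graph //= implybE negb_and /edges_meet !negbK.
rewrite !inE in iS jS; have /forall_inP/(_ _ jS) := H _ iS.
have lt_size (k : 'I_(size (line_graph r))) : k < size r.
  by rewrite -[ltnRHS](size_line_graph r).
rewrite adjacent_line_graph // implybE negb_and /edges_meet !negbK.
by rewrite -val_eqE.
Qed.

Lemma accepted_line_graph r x :
  accepted (size (line_graph r)) x
    = cast_ord (size_line_graph r) @^-1: accepted (size r) x.
Proof. by apply/setP => i; rewrite !inE. Qed.

Lemma maximum_independent_line_graph r x :
  maximum (@matching r) (accepted (size r) x) ->
  maximum (@independent (line_graph r)) (accepted (size (line_graph r)) x).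
Proof.
have card_cast (S : {set 'I_(size r)}) :
    #|cast_ord (size_line_graph r) @^-1: S| = #|S|.
  apply: on_card_preimset; exists (cast_ord (esym (size_line_graph r))).
    by move=> i _; rewrite cast_ordK.
  by move=> i _; rewrite cast_ordKV.
move=> [feas_x max_x]; split.
  by rewrite accepted_line_graph independent_line_graph.
(* Every competitor comes from a set of edges of the same cardinality, to which the maximality of
   the matching applies. *)
move=> S'; pose S := cast_ord (esym (size_line_graph r)) @^-1: S'.
have -> : S' = cast_ord (size_line_graph r) @^-1: S.
  by apply/setP => i; rewrite !inE cast_ordK.
rewrite independent_line_graph accepted_line_graph !card_cast.
exact: max_x.
Qed.

Lemma degree_line_graph r d (i : 'I_(size r)) :
  #|` nth fset0 r i| = 2 ->
  (forall v, #|[set j : 'I_(size r) | v \in nth fset0 r j]| <= d.+1) ->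
  #|[set j : 'I_(size (line_graph r)) | adjacent (line_graph r) i j]| <= d.*2.
Proof.
move=> card_i deg.
have [u [v ei]] : exists u v, nth fset0 r i = [fset u; v]%fset.
  have /fset0Pn[u ui] : nth fset0 r i != fset0 by rewrite -cardfs_gt0 card_i.
  have := card_i; rewrite (cardfsD1 u) ui => -[/eqP/cardfs1P[v ev]].
  by exists u, v; rewrite -(fsetD1K ui) ev.
(* Removing [i] itself lowers the bound [d.+1] at each endpoint to [d]. *)
pose at_end w := [set j : 'I_(size r) | w \in nth fset0 r j] :\ i.
have at_end_le w : w \in nth fset0 r i -> #|at_end w| <= d.
  move=> wi; have := deg w; rewrite (cardsD1 i) inE wi add1n ltnS.
  exact.
rewrite -(card_imset _ (@cast_ord_inj _ _ (size_line_graph r))).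
apply: (@leq_trans #|at_end u :|: at_end v|).
  apply/subset_leq_card/subsetP => _ /imsetP[j + ->]; rewrite inE.
  have ltj : j < size r by rewrite -[ltnRHS](size_line_graph r).
  rewrite adjacent_line_graph // !inE -val_eqE /= eq_sym => /andP[-> /=].
  by rewrite /edges_meet ei fdisjointUX !fdisjoint1X negb_and !negbK.
rewrite -addnn (leq_trans (leq_card_setU _ _).1) // leq_add //.
  by apply: at_end_le; rewrite ei !inE eqxx.
by apply: at_end_le; rewrite ei !inE eqxx orbT.
Qed.

Lemma BDIS_legal_line_graph t r :
  MAT_legal (omap (fun k => k %/ 2 + 1) t) r -> BDIS_legal t (line_graph r).
Proof.
move=> [edges _ deg]; split=> [i j|i].
  by rewrite in_nth_line_graph => /and3P[].
case: t deg => //= k deg.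
have lti : i < size r by rewrite -[ltnRHS](size_line_graph r).
(* Here [d] is [k %/ 2], so that [d.+1] is the degree bound of the matching problem; rounding down
   gives [d.*2 <= k]. *)
apply: (@leq_trans (k %/ 2).*2); last by lia.
apply: (@degree_line_graph r _ (Ordinal lti)).
  by apply: edges; apply: mem_nth.
by move=> v; rewrite -addn1; apply: deg.
Qed.

End LineGraph.

Section Reduction.

Variables (R : realType) (t : option nat).
Let s := omap (fun k => k %/ 2 + 1) t.

Definition line_graph_algorithm (A : algorithm (BDIS R t)) :
    algorithm (MAT R s) :=
  fun p => A (zip (line_graph (unzip1 p)) (unzip2 p)).

(** Each call rebuilds the line graph of the current prefix, which by [take_line_graph] is the
    prefix that [A] would see. Equal sizes let [zip] be undone on both sides. *)
Lemma run_line_graph_algorithm (A : algorithm (BDIS R t)) r x :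
  size x = size r ->
  run (line_graph_algorithm A) r x = run A (line_graph r) x.
Proof.
move=> sz; rewrite /run size_line_graph; apply: eq_map => i.
rewrite /line_graph_algorithm /unzip1 /unzip2 !map_take.
rewrite -/unzip1 -/unzip2 unzip1_zip ?unzip2_zip ?sz //.
by rewrite take_line_graph take_zip.
Qed.

Lemma profit_line_graph r y :
  profit (p := BDIS R t) (line_graph r) y = profit (p := MAT R s) r y.
Proof. by rewrite /= accepted_line_graph independent_line_graph. Qed.

Definition line_graph_instance (I : instance (MAT R s)) : instance (BDIS R t) :=
  @Instance R (BDIS R t) (opt_bits I) (pred_bits I) (line_graph (requests I))
    (etrans (size_opt_bits I) (esym (size_line_graph _)))
    (etrans (size_pred_bits I) (esym (size_line_graph _)))
    (BDIS_legal_line_graph (legal_requests I))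
    (maximum_independent_line_graph (opt_bitsP I)).

Lemma competitive_line_graph_algorithm (E : error_measures R)
    (A : algorithm (BDIS R t)) (alpha beta gamma : R) :
  competitive E A alpha beta gamma ->
  competitive E (line_graph_algorithm A) alpha beta gamma.
Proof.
move=> [a0 b0 c0 [b Hb]]; split=> //; exists b => I.
have := Hb (line_graph_instance I).
have -> : Alg A (line_graph_instance I) = Alg (line_graph_algorithm A) I.
  rewrite /Alg (run_line_graph_algorithm _ (size_pred_bits I)).
  exact: profit_line_graph.
(* Both instances carry the same bits, so their [mispredicted] vectors and hence the [eta] terms
   agree by conversion; only [Opt] is left to rewrite. *)
by rewrite /Opt profit_line_graph.
Qed.

End Reduction.

Theorem theorem4p20 (R : realType) (t : option nat) (t_pos : t <> Some 0%N)
    (E : error_measures R) :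
  as_hard_as E (BDIS R t) (MAT R (omap (fun k : nat => (k %/ 2 + 1)%N) t)).
Proof.
move=> alpha beta gamma [A [compA _]].
exists (line_graph_algorithm A).
exact: competitive_line_graph_algorithm.
Qed.
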